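(* Let $G_\phi$ be a connected signed graph with sink $q$ such that $G\setminus q$ is a tree. Then there is an isomorphism of critical groups $\mathcal{K}(G_\phi)\cong\mathcal{K}(|G|)$.
   Context: A signed graph $G_\phi$ is a finite simple graph $G=(V,E)$ with a sign function $\phi:E\to\{+,-\}$; $|G|$ denotes the signed graph on $G$ with all edges positive. $G\setminus q$ is the graph obtained by deleting the vertex $q$. With sink $q$ and nonsink vertices $v_1,\dots,v_n$, the reduced signed Laplacian $L_{G_\phi}$ is the $n\times n$ matrix with diagonal entries $\deg_G(v_i)$ (counting edges to $q$) and, for $i\neq j$, $(i,j)$ entry $-1$ if $v_iv_j$ is a positive edge, $+1$ if it is a negative edge, $0$ if it is not an edge. The critical group is $\mathcal{K}(G_\phi)=\mathbb{Z}^n/\mathrm{im}\,L_{G_\phi}$; the same sink $q$ is used for both groups. *)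

(* Defs.v *)
From HB Require Import structures.
From mathcomp Require Import all_boot all_algebra.
From mathcomp Require Import boolp.

Set Implicit Arguments.
Unset Strict Implicit.
Unset Printing Implicit Defensive.

Import GRing.Theory.
Local Open Scope ring_scope.

Record simple_graph (V : finType) := SimpleGraph {
  adj :> rel V;
  adj_sym : symmetric adj;
  adj_irr : irreflexive adj
}.

Section Graphs.
Variable V : finType.
Implicit Type G : simple_graph V.

Definition degree G (v : V) : nat := #|[set w | G v w]|.

Definition connected_graph G : Prop := forall u v : V, connect G u v.

(* [ucycle] also counts the one-point and two-point (back and forth along an
   edge) closed walks, hence the bound on the size. *)
Definition acyclic_graph G : Prop :=
  forall c : seq V, ucycle G c -> (size c <= 2)%N.

(* The graph without vertices counts as a tree. *)
Definition tree G : Prop := connected_graph G /\ acyclic_graph G.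

Section DeleteVertex.
Variables (G : simple_graph V) (q : V).

Definition del_adj : rel {v : V | v != q} := fun u v => G (val u) (val v).

Lemma del_adj_sym : symmetric del_adj.
Proof. by move=> u v; exact: adj_sym. Qed.

Lemma del_adj_irr : irreflexive del_adj.
Proof. by move=> u; exact: adj_irr. Qed.

Definition delete_vertex : simple_graph {v : V | v != q} :=
  SimpleGraph del_adj_sym del_adj_irr.
End DeleteVertex.

End Graphs.

(* The edge {u, v} is the two-element set [set u; v]; it is negative when
   [negative] holds of it and positive otherwise. The values of [negative] on
   sets that are not edges are never used. *)
Record signed_graph (V : finType) := SignedGraph {
  underlying :> simple_graph V;
  negative : {set V} -> bool
}.

Definition all_positive (V : finType) (G : signed_graph V) : signed_graph V :=
  SignedGraph (underlying G) (fun=> false).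

Section CriticalGroup.
Variables (V : finType) (G : signed_graph V) (q : V).

Definition nonsink : {set V} := [set~ q].

(* The nonsink vertices are listed as enum_val i, for i : 'I_#|nonsink|. *)
Definition reduced_laplacian : 'M[int]_#|nonsink| :=
  \matrix_(i, j)
    let u := enum_val i in
    let v := enum_val j in
    if i == j then (degree G u)%:Z
    else if G u v then (if negative G [set u; v] then 1 else -1)
    else 0.

End CriticalGroup.

Section Cokernel.
Variables (n : nat) (L : 'M[int]_n).

Definition int_image : {pred 'cV[int]_n} :=
  fun y => `[< exists x : 'cV[int]_n, y = L *m x >].

Lemma int_image_zmod_closed : zmod_closed int_image.
Proof.
split=> [|y z]; first by apply/asboolP; exists 0; rewrite mulmx0.
by move=> /asboolP[x ->] /asboolP[x' ->]; apply/asboolP; exists (x - x'); rewrite mulmxBr.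
Qed.

HB.instance Definition _ :=
  GRing.isZmodClosed.Build 'cV[int]_n int_image int_image_zmod_closed.

Definition cokernel : zmodType := Quotient.quot int_image.
End Cokernel.

Definition critical_group (V : finType) (G : signed_graph V) (q : V) : zmodType :=
  cokernel (reduced_laplacian G q).

(* Main.v *)
Require Import Defs.
From HB Require Import structures.
From mathcomp Require Import all_boot all_algebra.
From mathcomp Require Import boolp.

(** The cokernel of an integer matrix [L] depends, up to isomorphism, only on
    the class of [L] under [L |-> U L W^-1] with [U] and [W] invertible over
    the integers ([equivalent_cokernel_iso]). Conjugating the reduced signed
    Laplacian by the diagonal matrix of signs [(-1) ^ s v] is such a change. It
    leaves the diagonal alone and multiplies the entry at an edge [uv] by
    [(-1) ^ (s u + s v)]. Hence all edges become positive as soon as some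
    function [s] with values in Z/2 satisfies [s u + s v = 1] on the negative
    edges and [s u + s v = 0] on the positive ones.

    Only the edges between nonsink vertices occur off the diagonal, and they
    form a tree, on which every Z/2-valued edge labelling is the coboundary of
    a vertex labelling ([tree_switching]): the labelling [s] is extended one
    vertex at a time over a growing connected set, and a new vertex never meets
    two constraints, because two neighbours in the connected set would close a
    cycle ([acyclic_unique_neighbour]). *)

Set Implicit Arguments.
Unset Strict Implicit.
Unset Printing Implicit Defensive.

Import GRing.Theory.
Local Open Scope ring_scope.
Local Open Scope quotient_scope.

Section TreeSwitching.
Variables (T : finType) (G : simple_graph T).

Definition induced_adj (A : {set T}) : rel T :=
  fun u v => [&& u \in A, v \in A & G u v].

Definition connected_set (A : {set T}) : Prop :=
  {in A &, forall u v, connect (induced_adj A) u v}.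

Lemma induced_adj_connect_sym A : connect_sym (induced_adj A).
Proof.
apply: sym_connect_sym => u v.
by rewrite /induced_adj adj_sym andbA [(u \in A) && _]andbC -andbA.
Qed.

Lemma induced_path A u p :
  path (induced_adj A) u p -> path G u p /\ {subset p <= A}.
Proof.
elim: p u => [|x p IHp] u //= /andP[/and3P[_ xA Gux] /IHp[Gp pA]].
split; first by rewrite Gux.
by move=> y /predU1P[->|/pA].
Qed.

(** A simple path inside [A] between two neighbours of [v] becomes a cycle
    through [v]. *)
Lemma acyclic_unique_neighbour A u v w :
  acyclic_graph G -> connected_set A -> v \notin A ->
  u \in A -> w \in A -> G v u -> G v w -> u = w.
Proof.
move=> acG cA vA uA wA Gvu Gvw.
have /connectP[p0 /shortenP[p Ap Up _] ew] := cA u w uA wA.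
have [Gp pA] := induced_path Ap.
have vup : v \notin u :: p.
  by apply: contra vA => /predU1P[->|/pA].
have /acG : ucycle G (v :: u :: p).
  apply/andP; split; last by rewrite cons_uniq vup.
  by rewrite /cycle rcons_path /= Gvu Gp -ew adj_sym Gvw.
by case: p ew {Ap Up Gp pA vup} => [|x p] //=.
Qed.

Lemma connected_setU1 A u v :
  connected_set A -> u \in A -> G u v -> connected_set (v |: A).
Proof.
move=> cA uA Guv.
have subA x y : connect (induced_adj A) x y ->
    connect (induced_adj (v |: A)) x y.
  apply: connect_sub => a b /and3P[aA bA Gab]; apply: connect1.
  by rewrite /induced_adj !inE aA bA Gab !orbT.
have to_u x : x \in v |: A -> connect (induced_adj (v |: A)) x u.
  case/setU1P=> [->|xA]; last exact: subA (cA _ _ xA uA).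
  rewrite induced_adj_connect_sym; apply: connect1.
  by rewrite /induced_adj setU11 setU1r.
move=> x y /to_u xu /to_u yu; apply: connect_trans xu _.
by rewrite induced_adj_connect_sym.
Qed.

Lemma connected_boundary_edge (A : {set T}) r :
  connected_graph G -> r \in A -> A != setT ->
  exists u v, [/\ u \in A, v \notin A & G u v].
Proof.
move=> cG rA nT; apply: contrapT => noedge; case/negP: nT.
apply/eqP/setP=> w; rewrite inE -rA; apply/esym.
apply: (@closed_connect _ G) (cG r w).
apply: (intro_closed (sym_connect_sym (@adj_sym _ G))) => u v Guv uA.
by apply: contraPT noedge => vA; apply; exists u, v.
Qed.

(** There is no cycle around which [e] could have a nonzero sum, so it is the
    coboundary of some [s]. The induction is on the number of vertices outside
    a connected set [A] on whose induced edges [s] is already right. *)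
Lemma tree_switching (e : T -> T -> bool) :
  tree G -> (forall u v, e u v = e v u) ->
  exists s : T -> bool, forall u v, G u v -> s u (+) s v = e u v.
Proof.
case=> cG acG e_sym.
case: (pickP (fun _ : T => true)) => [r _|T0]; last first.
  by exists xpred0 => u; have := T0 u.
suff grow (A : {set T}) (s : T -> bool) :
    r \in A -> connected_set A ->
    {in A &, forall u v, G u v -> s u (+) s v = e u v} ->
    exists s' : T -> bool, forall u v, G u v -> s' u (+) s' v = e u v.
  apply: (grow [set r] xpred0); first exact: set11.
  - by move=> u v /set1P-> /set1P->; apply: connect0.
  - by move=> u v /set1P-> /set1P->; rewrite adj_irr.
have [m] := ubnP #|~: A|; elim: m => // m IHm in A s *.
rewrite ltnS => leAm rA cA sA.
have [AT|nT] := eqVneq A setT.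
  by exists s => u v; apply: sA; rewrite AT.
have [u [v [uA vA Guv]]] := connected_boundary_edge cG rA nT.
(* [u] is the only neighbour of [v] in [A], so it dictates the value at [v]. *)
pose s' x := if x == v then s u (+) e u v else s x.
have s'v : s' v = s u (+) e u v by rewrite /s' eqxx.
have s'A x : x \in A -> s' x = s x.
  by rewrite /s'; case: eqP => // -> ; rewrite (negPf vA).
have s'_nbr x : x \in A -> G v x -> s' v (+) s' x = e v x.
  move=> xA Gvx; have Gvu : G v u by rewrite adj_sym.
  rewrite -(acyclic_unique_neighbour acG cA vA uA xA Gvu Gvx).
  by rewrite s'v s'A // addbC addKb e_sym.
apply: (IHm (v |: A) s').
- apply: leq_trans leAm; apply: proper_card; rewrite properC.
  by rewrite properE subsetUr subUset sub1set (negPf vA).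
- exact: setU1r.
- exact: connected_setU1 cA uA Guv.
move=> x y /setU1P[->|xA] /setU1P[->|yA] Gxy.
- by rewrite adj_irr in Gxy.
- exact: s'_nbr.
- by rewrite addbC e_sym; apply: s'_nbr; rewrite // adj_sym.
- by rewrite !s'A //; apply: sA.
Qed.

End TreeSwitching.

Section CokernelMaps.
Variable n : nat.
Implicit Types L M U W : 'M[int]_n.

Lemma cokernel_eqP L (x y : 'cV[int]_n) :
  reflect (exists z, x - y = L *m z) (\pi_(cokernel L) x == \pi_(cokernel L) y).
Proof. by rewrite -Quotient.idealrBE; apply: asboolP. Qed.

(** The map induced by [U], computed on a chosen representative; it does not
    depend on the choice once [U] sends the image of [L] into that of [M]
    ([cokernel_map_pi]). *)
Definition cokernel_map L M U (x : cokernel L) : cokernel M :=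
  \pi_(cokernel M) (U *m repr x).

Lemma cokernel_map_pi L M U W (x : 'cV[int]_n) : U *m L = M *m W ->
  cokernel_map M U (\pi_(cokernel L) x) = \pi_(cokernel M) (U *m x).
Proof.
move=> ULMW; apply/eqP/cokernel_eqP.
have /cokernel_eqP[z Ez] :
    \pi_(cokernel L) (repr (\pi_(cokernel L) x)) == \pi_(cokernel L) x.
  by rewrite reprK.
by exists (W *m z); rewrite -mulmxBr Ez !mulmxA ULMW.
Qed.

Lemma cokernel_map_zmod_morphism L M U W : U *m L = M *m W ->
  zmod_morphism (@cokernel_map L M U).
Proof.
move=> ULMW x y; rewrite -[x]reprK -[y]reprK -raddfB.
by rewrite !(cokernel_map_pi _ ULMW) mulmxBr raddfB.
Qed.

Lemma cokernel_mapK L M U U' W W' :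
  U *m L = M *m W -> U' *m M = L *m W' -> U' *m U = 1%:M ->
  cancel (@cokernel_map L M U) (@cokernel_map M L U').
Proof.
move=> ULMW ULMW' U'U x; rewrite -[x]reprK.
by rewrite (cokernel_map_pi _ ULMW) (cokernel_map_pi _ ULMW') mulmxA U'U mul1mx.
Qed.

Lemma equivalent_cokernel_iso L M U W :
  U \in unitmx -> W \in unitmx -> U *m L = M *m W ->
  exists f : {additive cokernel L -> cokernel M}, bijective f.
Proof.
move=> uU uW ULMW.
have ULMW' : invmx U *m M = L *m invmx W.
  by apply: (canRL (mulmxK uW)); rewrite -mulmxA -ULMW mulKmx.
pose zf := GRing.isZmodMorphism.Build _ _ _ (cokernel_map_zmod_morphism ULMW).
pose f : {additive cokernel L -> cokernel M} :=
  HB.pack (@cokernel_map L M U) zf.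
exists f; exists (@cokernel_map M L (invmx U)).
- exact: cokernel_mapK ULMW ULMW' (mulVmx uU).
- exact: cokernel_mapK ULMW' ULMW (mulmxV uU).
Qed.

End CokernelMaps.

Definition sign_mx n (s : 'I_n -> bool) : 'M[int]_n :=
  diag_mx (\row_i (-1) ^+ s i).

Lemma sign_mx_unit n (s : 'I_n -> bool) : sign_mx s \in unitmx.
Proof.
rewrite unitmxE det_diag; apply: rpred_prod => i _.
by rewrite mxE rpredX ?unitrN1.
Qed.

(** [D] is its own inverse, so this is conjugation of the Laplacian by [D]; it
    is written without inverses to compare entries directly. *)
Lemma switching_laplacian (V : finType) (G : signed_graph V) (q : V)
    (s : V -> bool) :
  (forall u v, u != q -> v != q -> G u v ->
     s u (+) s v = negative G [set u; v]) ->
  let D := sign_mx (fun i : 'I_#|nonsink q| => s (enum_val i)) in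
  D *m reduced_laplacian G q = reduced_laplacian (all_positive G) q *m D.
Proof.
move=> sP D; apply/matrixP=> i j.
rewrite mul_diag_mx mul_mx_diag !mxE /=.
case: eqP => [->|_]; first by rewrite mulrC.
case Gij: (adj _ _ _); last by rewrite mulr0 mul0r.
have nq (k : 'I_#|nonsink q|) : enum_val k != q.
  by have := enum_valP k; rewrite !inE.
rewrite -(sP _ _ (nq i) (nq j) Gij).
by case: (s _); case: (s _).
Qed.

Theorem corollary4p3 (V : finType) (G : signed_graph V) (q : V) :
  connected_graph G ->
  tree (delete_vertex G q) ->
  exists f : {additive critical_group G q -> critical_group (all_positive G) q},
    bijective f.
Proof.
move=> _ treeGq.
have [|s sP] := @tree_switching _ _
  (fun u v => negative G [set val u; val v]) treeGq.
  by move=> u v; rewrite setUC.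
(* The value chosen at the sink is arbitrary. *)
pose s' v := if insub v is Some w then s w else false.
have s'P u v : u != q -> v != q -> G u v ->
    s' u (+) s' v = negative G [set u; v].
  by move=> uq vq Guv; rewrite /s' !insubT; apply: sP.
exact: equivalent_cokernel_iso (sign_mx_unit _) (sign_mx_unit _)
  (switching_laplacian s'P).
Qed.
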